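(* For $v\in(-1,1)$ let $M_v$ be the global maximum of $T_v$ on $[0,1]$ and let $E_v\subset[0,1]$ be the set of points where it is attained. Then: 1) If $1/2<v<1$, then $E_v=\{1/3,2/3\}$ and $M_v=\dfrac1{3(1-v)}$. 2) If $v=1/2$, then $E_v$ consists of the points having a binary expansion $0.x_1x_2\dots x_n\dots$ satisfying $x_{2k+1}+x_{2k+2}=1$ for $k=0,1,\dots$ (equivalently, an expansion that is an infinite concatenation of two-digit blocks each equal to $01$ or $10$). Also $M_v=2/3$, $\inf E_v=1/3$, $\sup(E_v\cap[0,1/2])=5/12$, $\sup E_v=2/3$. 3) If $-1/2\le v\le1/4$, then $E_v=\{1/2\}$ and $M_v=1/2$. 4) If $-1<v<-1/2$, then: 4a) For any $k\in\mathbb N$ the polynomial $\widetilde P_{2k}(x)=1-2x-4x^2-\dots-2^{2k}x^{2k}$ has a single negative root $v_k$, and $v_k\in(-1,-1/2)$. The sequence $(v_k)_{k\ge1}$ is strictly increasing, and $v_k=-\frac12-\frac{\ln3}{4k}+O(1/k^2)$ as $k\to\infty$. 4b) If $k\in\mathbb N$ and $v\in(v_{k-1},v_k)$ (where $v_0=-1$), then $E_v=\{x_{\max,k}^-,x_{\max,k}^+\}$, where $$x_{\max,k}^-=\frac12-\frac1{5\cdot2^{2k-1}},\qquad x_{\max,k}^+=\frac12+\frac1{5\cdot2^{2k-1}},$$ and $$M_v=\frac12+\frac{4v-1}{5\cdot2^{2k-1}(1-2v)}-\frac{3v^{2k+1}}{5(1-v^2)(1-2v)}.\qquad( * )$$ 4c)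 If $k\in\mathbb N$ and $v=v_k$, then $E_v=\{x_{\max,k}^-,x_{\max,k+1}^-,x_{\max,k+1}^+,x_{\max,k}^+\}$, with these points given by the formulas in 4b), and $M_v$ is given by formula $( * )$.
   Context: $\mathbb N=\{1,2,\dots\}$. $T_0(x)$ is the distance from $x\in\mathbb R$ to the nearest integer, and for $v\in(-1,1)$, $T_v(x)=\sum_{n=0}^\infty v^nT_0(2^nx)$. *)

(* Defs.v *)
From Stdlib Require Import Reals ZArith Lra Lia.
From Coquelicot Require Import Coquelicot.

Open Scope R_scope.

Definition T0 (x : R) : R :=
  real (Glb_Rbar (fun d => exists z : Z, d = Rabs (x - IZR z))).

(* The infimum defining [T0] is attained. *)
Lemma T0_nearest (x : R) :
  exists z : Z, T0 x = Rabs (x - IZR z) /\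
    forall z' : Z, Rabs (x - IZR z) <= Rabs (x - IZR z').
Proof.
assert (H : exists z : Z,
          forall z' : Z, Rabs (x - IZR z) <= Rabs (x - IZR z')).
{ destruct (archimed (x - / 2)) as [H1 H2].
  set (z := up (x - / 2)) in *.
  exists z; intros z'.
  assert (Hz : Rabs (x - IZR z) <= / 2) by (apply Rabs_le; lra).
  destruct (Z.eq_dec z' z) as [-> | Hne]; [lra |].
  assert (Hd : 1 <= Rabs (IZR z' - IZR z)).
  { rewrite <- minus_IZR, <- abs_IZR. apply IZR_le. lia. }
  assert (Ht := Rabs_triang (x - IZR z) (- (x - IZR z'))).
  rewrite Rabs_Ropp in Ht.
  replace (x - IZR z + - (x - IZR z')) with (IZR z' - IZR z) in Ht by ring.
  lra. }
destruct H as [z Hz].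
exists z; split; [| exact Hz].
unfold T0.
rewrite (is_glb_Rbar_unique _ (Finite (Rabs (x - IZR z)))); [reflexivity |].
split.
- intros d [z' ->]; apply Hz.
- intros b Hb; apply Hb; exists z; reflexivity.
Qed.

Definition T (v x : R) : R :=
  Series (fun n : nat => v ^ n * T0 (2 ^ n * x)).

(* [is_M v m] says that the global maximum M_v exists and equals [m]. *)
Definition is_M (v m : R) : Prop :=
  (exists x, 0 <= x <= 1 /\ T v x = m) /\
  (forall x, 0 <= x <= 1 -> T v x <= m).

Definition E (v x : R) : Prop := 0 <= x <= 1 /\ is_M v (T v x).

(* Digits are numbered from 1; the value [b 0] is irrelevant. *)
Definition binary_expansion (b : nat -> nat) (x : R) : Prop :=
  (forall n : nat, (1 <= n)%nat -> b n = 0%nat \/ b n = 1%nat) /\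
  is_series (fun n : nat => INR (b (S n)) / 2 ^ S n) x.

Definition Ptilde (n : nat) (x : R) : R :=
  1 - sum_n_m (fun j : nat => 2 ^ j * x ^ j) 1 n.

(* Used for k >= 1 only, where the truncated [2 * k - 1] is exact. *)
Definition xmax_minus (k : nat) : R := 1 / 2 - 1 / (5 * 2 ^ (2 * k - 1)).
Definition xmax_plus (k : nat) : R := 1 / 2 + 1 / (5 * 2 ^ (2 * k - 1)).

Definition Mformula (k : nat) (v : R) : R :=
  1 / 2 + (4 * v - 1) / (5 * 2 ^ (2 * k - 1) * (1 - 2 * v))
  - 3 * v ^ (2 * k + 1) / (5 * (1 - v ^ 2) * (1 - 2 * v)).

(* Main.v *)
Require Import Defs.
From Stdlib Require Import Reals ZArith Lra Lia.
From Coquelicot Require Import Coquelicot.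

(** On [0, 1/2] the function satisfies T_v(x) = x + v T_v(2x), and it is bounded
    and symmetric about 1/2. Hence an upper bound "T_v <= h" holds as soon as
    "T_v <= h + B" implies "T_v <= h + r B" for some r < 1, and every extremal
    estimate reduces to finding a majorant h compatible with the doubling map.

    For v >= 1/2, h is piecewise linear with a corner at the fixed point 1/3.
    For 0 <= v <= 1/4, h is the parabola 2x(1 - x), which is T_{1/4}; for
    -1/2 <= v <= 0 one shows T_v >= 0, so that T_v(x) <= x.

    For v = -y/2 with 1 < y < 2, h is piecewise linear with slopes 1 and 1/y and
    a corner at 2/5, a point of the period-two orbit {1/5, 2/5}. Near 1/2, with
    u = 4^j d, one has
    T_v(1/2 - d) = 1/2 + v^(2j) (T_v(u) - lambda_j u), where
    lambda_j = (1 + (1 + 2y) / y^(2j)) / (1 + y) decreases in j. The majorant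
    maximizes the bracket at u = 2/5 when 1/y < lambda_k <= 1, that is,
    y^(2k-1) < 1 + 2y <= y^(2k+1); if lambda_j > 1, then scale j is beaten by
    scale j + 1. The thresholds y^(2k+1) = 1 + 2y are the roots of
    Ptilde_{2k}, since (1 + y) Ptilde_{2k}(-y/2) = 1 + 2y - y^(2k+1). *)

Open Scope R_scope.

(** * Distance to the nearest integer, functional equations of [T], extremal principles *)

Lemma T0_le (x : R) (z : Z) : T0 x <= Rabs (x - IZR z).
Proof.
destruct (T0_nearest x) as [z0 [-> H]]; apply H.
Qed.

Lemma T0_ge0 (x : R) : 0 <= T0 x.
Proof.
destruct (T0_nearest x) as [z [-> _]]; apply Rabs_pos.
Qed.

Lemma T0_le1 (x : R) : T0 x <= 1.
Proof.
eapply Rle_trans; [apply (T0_le x (up x)) |].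
destruct (archimed x); apply Rabs_le; lra.
Qed.

Lemma T0_id (x : R) : 0 <= x <= 1 / 2 -> T0 x = x.
Proof.
intros Hx; apply Rle_antisym.
- eapply Rle_trans; [apply (T0_le x 0) |].
  rewrite Rabs_pos_eq; lra.
- destruct (T0_nearest x) as [z [-> _]].
  destruct (Z_le_gt_dec z 0) as [Hz | Hz].
  + apply IZR_le in Hz; rewrite Rabs_pos_eq; lra.
  + assert (H1 : IZR 1 <= IZR z) by (apply IZR_le; lia).
    rewrite <- Rabs_Ropp, Rabs_pos_eq; lra.
Qed.

(** One inequality at every point suffices, because y -> n - y is an involution. *)
Lemma T0_reflect (n : Z) (x : R) : T0 (IZR n - x) = T0 x.
Proof.
assert (H : forall y : R, T0 (IZR n - y) <= T0 y).
{ intros y; destruct (T0_nearest y) as [z [-> _]].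
  eapply Rle_trans; [apply (T0_le _ (n - z)) |].
  rewrite minus_IZR, <- Rabs_Ropp; right; f_equal; ring. }
apply Rle_antisym; [apply H |].
replace x with (IZR n - (IZR n - x)) at 1 by ring; apply H.
Qed.

Lemma T_term_le (v x : R) (n : nat) :
  norm (v ^ n * T0 (2 ^ n * x)) <= Rabs v ^ n.
Proof.
change (norm (v ^ n * T0 (2 ^ n * x))) with (Rabs (v ^ n * T0 (2 ^ n * x))).
rewrite Rabs_mult, <- RPow_abs, (Rabs_pos_eq (T0 _)) by apply T0_ge0.
rewrite <- (Rmult_1_r (Rabs v ^ n)) at 2.
apply Rmult_le_compat_l; [apply pow_le, Rabs_pos | apply T0_le1].
Qed.

Section TakagiFunction.

Variable v : R.
Hypothesis Hv : -1 < v < 1.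

Let Habs : Rabs v < 1.
Proof. apply Rabs_def1; lra. Qed.

Let Hgeom : ex_series (fun n => Rabs v ^ n).
Proof. apply ex_series_geom; rewrite Rabs_Rabsolu; exact Habs. Qed.

(** Supplies the a priori bound from which [contraction_le] starts. *)
Lemma T_bounded : exists B : R, 0 <= B /\ forall x : R, Rabs (T v x) <= B.
Proof.
exists (Series (fun n => Rabs v ^ n)); split.
- rewrite Series_geom by (rewrite Rabs_Rabsolu; exact Habs).
  apply Rlt_le, Rinv_0_lt_compat; lra.
- intros x; unfold T.
  eapply Rle_trans; [apply Series_Rabs |].
  + apply (ex_series_le (K := R_AbsRing) (V := R_CompleteNormedModule))
      with (b := fun n => Rabs v ^ n); [| exact Hgeom].
    intros n; unfold norm; simpl; unfold abs; simpl.
    rewrite Rabs_Rabsolu; apply T_term_le.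
  + apply Series_le; [| exact Hgeom].
    intros n; split; [apply Rabs_pos | apply T_term_le].
Qed.

Lemma T_rec (x : R) : T v x = T0 x + v * T v (2 * x).
Proof.
unfold T; rewrite Series_incr_1.
- rewrite <- Series_scal_l; f_equal.
  + simpl; rewrite !Rmult_1_l; reflexivity.
  + apply Series_ext; intros n; simpl.
    rewrite (Rmult_comm 2 (2 ^ n)), Rmult_assoc, Rmult_assoc; reflexivity.
- apply (ex_series_le (K := R_AbsRing) (V := R_CompleteNormedModule))
    with (b := fun n => Rabs v ^ n); [apply T_term_le | exact Hgeom].
Qed.

Lemma T_reflect (x : R) : T v (1 - x) = T v x.
Proof.
apply Series_ext; intros n; f_equal.
replace (2 ^ n * (1 - x)) with (IZR (2 ^ Z.of_nat n) - 2 ^ n * x).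
- apply T0_reflect.
- rewrite <- pow_IZR; ring.
Qed.

Lemma T_double (x : R) : 0 <= x <= 1 / 2 -> T v x = x + v * T v (2 * x).
Proof. intros Hx; rewrite T_rec, T0_id by exact Hx; reflexivity. Qed.

Lemma T_at_0 : T v 0 = 0.
Proof.
assert (H := T_double 0 ltac:(lra)).
rewrite Rmult_0_r in H; nra.
Qed.

Lemma T_at_half : T v (1 / 2) = 1 / 2.
Proof.
rewrite T_double by lra.
replace (2 * (1 / 2)) with (1 - 0) by field.
rewrite T_reflect, T_at_0; ring.
Qed.

Lemma T_fold (x : R) : 1 / 4 <= x <= 1 / 2 -> T v x = x + v * T v (1 - 2 * x).
Proof. intros Hx; rewrite T_reflect; apply T_double; lra. Qed.

(** Two doublings give the factor [v ^ 2], nonnegative even for v < 0, so one-sided bounds on [T]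
    pass through the recursion. *)
Lemma T_quad_low (x : R) :
  0 <= x <= 1 / 4 -> T v x = (1 + 2 * v) * x + v ^ 2 * T v (4 * x).
Proof.
intros Hx; rewrite T_double, (T_double (2 * x)) by lra.
replace (2 * (2 * x)) with (4 * x) by ring; ring.
Qed.

(** Folding sends 1/2 - d to 2d, which doubles to 4d: the graph near 1/2 is modelled on the graph
    near 0. *)
Lemma T_quad_high (d : R) :
  0 <= d <= 1 / 4 ->
  T v (1 / 2 - d) = 1 / 2 - (1 - 2 * v) * d + v ^ 2 * T v (4 * d).
Proof.
intros Hd; rewrite T_fold by lra.
replace (1 - 2 * (1 / 2 - d)) with (2 * d) by field.
rewrite T_double by lra.
replace (2 * (2 * d)) with (4 * d) by ring; field.
Qed.

End TakagiFunction.

(** Iterating the step bounds [g] by r^n B, which tends to 0. A general [P] also covers sets other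
    than intervals, such as the block points. *)
Lemma contraction_le (P : R -> Prop) (g : R -> R) (r : R) :
  0 <= r < 1 ->
  (exists B : R, 0 <= B /\ forall x : R, P x -> g x <= B) ->
  (forall B : R, 0 <= B -> (forall x : R, P x -> g x <= B) ->
     forall x : R, P x -> g x <= r * B) ->
  forall x : R, P x -> g x <= 0.
Proof.
intros Hr [B [HB Hg]] Hstep x Hx.
assert (Hn : forall n : nat, forall y : R, P y -> g y <= r ^ n * B).
{ induction n as [| n IH]; intros y Hy.
  - simpl; specialize (Hg y Hy); lra.
  - simpl; rewrite Rmult_assoc; apply Hstep; auto.
    apply Rmult_le_pos; [apply pow_le; lra | exact HB]. }
apply Rnot_lt_le; intros Hpos.
assert (Hlim : is_lim_seq (fun n => r ^ n * B) 0).
{ replace (Finite 0) with (Rbar_mult 0 B) by (simpl; f_equal; ring).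
  apply is_lim_seq_scal_r, is_lim_seq_geom.
  rewrite Rabs_pos_eq; lra. }
assert (H : Rbar_le (g x) 0).
{ apply (is_lim_seq_le (fun _ => g x) (fun n => r ^ n * B)); auto.
  apply is_lim_seq_const. }
simpl in H; lra.
Qed.

Lemma E_iff (v m : R) :
  is_M v m -> forall x : R, E v x <-> 0 <= x <= 1 /\ T v x = m.
Proof.
intros [[x0 [Hx0 H0]] Hm] x; split.
- intros [Hx [_ H]]; split; [exact Hx |].
  apply Rle_antisym; [apply Hm, Hx |].
  rewrite <- H0; apply H, Hx0.
- intros [Hx H]; split; [exact Hx |]; split.
  + exists x; auto.
  + intros z Hz; rewrite H; apply Hm, Hz.
Qed.

Lemma is_M_intro (v m x0 : R) :
  -1 < v < 1 -> 0 <= x0 <= 1 / 2 -> T v x0 = m ->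
  (forall x : R, 0 <= x <= 1 / 2 -> T v x <= m) -> is_M v m.
Proof.
intros Hv Hx0 H0 H; split.
- exists x0; split; [lra | exact H0].
- intros x Hx; destruct (Rle_dec x (1 / 2)) as [Hle | Hgt].
  + apply H; lra.
  + rewrite <- T_reflect; apply H; lra.
Qed.

(** * The range 1/2 <= v < 1, with a maximum at 1/3 *)

Lemma T_third (v : R) : -1 < v < 1 -> T v (1 / 3) = 1 / (3 * (1 - v)).
Proof.
(* The point 1/3 is fixed by x -> 1 - 2x, so folding gives a linear equation for the value there. *)
intros Hv; assert (H := T_fold v Hv (1 / 3) ltac:(lra)).
replace (1 - 2 * (1 / 3)) with (1 / 3) in H by field.
apply (Rmult_eq_reg_l (1 - v)); [| lra].
field_simplify; lra.
Qed.

(* The majorant h(s) = min(s, (1 - 2v) s) <= 0 is compatible with the doubling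
   map because s -> -2s exchanges its two branches near the fixed point 1/3. *)
Lemma T_le_third (v x : R) :
  1 / 2 <= v < 1 -> 0 <= x <= 1 / 2 ->
  T v x <= 1 / (3 * (1 - v)) + Rmin (x - 1 / 3) ((1 - 2 * v) * (x - 1 / 3)).
Proof.
intros Hv Hx; assert (Hv1 : -1 < v < 1) by lra.
pose proof (T_third v Hv1) as H3.
assert (Hc : (1 - v) * T v (1 / 3) = 1 / 3) by (rewrite H3; field; lra).
rewrite <- H3; clear H3.
set (c := T v (1 / 3)) in *.
set (h := fun x => Rmin (x - 1 / 3) ((1 - 2 * v) * (x - 1 / 3))).
assert (Hlow : forall z, z <= 1 / 3 -> h z = z - 1 / 3).
{ intros z Hz; unfold h; apply Rmin_left; nra. }
assert (Hhigh : forall z, 1 / 3 <= z -> h z = (1 - 2 * v) * (z - 1 / 3)).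
{ intros z Hz; unfold h; apply Rmin_right; nra. }
enough (T v x - c - h x <= 0) by (unfold h in *; lra).
revert x Hx; apply (contraction_le _ _ v); [lra | |].
- destruct (T_bounded v Hv1) as [B [HB HT]].
  exists (B + Rabs c + 2); split; [assert (Hp := Rabs_pos c); lra |].
  intros x Hx.
  assert (H1 := Rle_abs (T v x)); specialize (HT x).
  assert (H2 := Rle_abs (- c)); rewrite Rabs_Ropp in H2.
  assert (H4 : - 2 <= h x) by (unfold h; apply Rmin_glb; nra).
  lra.
- intros B HB IH x Hx.
  assert (IH0 : forall z, 0 <= z <= 1 / 2 -> T v z <= c + B).
  { intros z Hz; specialize (IH z Hz).
    destruct (Rle_dec z (1 / 3)) as [Hle | Hgt].
    - rewrite Hlow in IH by lra; lra.
    - rewrite Hhigh in IH by lra; nra. }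
  destruct (Rle_dec x (1 / 3)) as [Hle | Hgt].
  + rewrite Hlow by lra.
    (* Left of 1/3 the crude bound [IH0] is enough: c = 1/3 + v c turns x + v c into c + (x -
       1/3). *)
    enough (H : T v x <= x + v * (c + B)) by nra.
    destruct (Rle_dec x (1 / 4)) as [Hq | Hq].
    * rewrite T_double by lra.
      assert (H := IH0 (2 * x) ltac:(lra)); nra.
    * rewrite T_fold by lra.
      assert (H := IH0 (1 - 2 * x) ltac:(lra)); nra.
  (* Folding leads to 1 - 2x < 1/3, where [h] has slope 1; this produces the slope 1 + v * (-2). *)
  + rewrite Hhigh by lra.
    rewrite T_fold by lra.
    assert (H := IH (1 - 2 * x) ltac:(lra)).
    rewrite Hlow in H by lra; nra.
Qed.

Lemma is_M_third (v : R) : 1 / 2 <= v < 1 -> is_M v (1 / (3 * (1 - v))).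
Proof.
intros Hv; apply (is_M_intro v _ (1 / 3)); [lra | lra | apply T_third; lra |].
intros x Hx; eapply Rle_trans; [apply T_le_third; assumption |].
destruct (Rle_dec x (1 / 3)).
- assert (H := Rmin_l (x - 1 / 3) ((1 - 2 * v) * (x - 1 / 3))); lra.
- assert (H := Rmin_r (x - 1 / 3) ((1 - 2 * v) * (x - 1 / 3))); nra.
Qed.

(** For v > 1/2 the majorant falls strictly on both sides of 1/3, so equality pins the point down;
    at v = 1/2 it is flat on the right. *)
Lemma maximizers_large (v x : R) :
  1 / 2 < v < 1 -> (E v x <-> x = 1 / 3 \/ x = 2 / 3).
Proof.
intros Hv; assert (Hv1 : -1 < v < 1) by lra.
rewrite (E_iff v _ (is_M_third v ltac:(lra))); split.
- intros [Hx HT].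
  assert (Hhalf : forall z, 0 <= z <= 1 / 2 ->
            T v z = 1 / (3 * (1 - v)) -> z = 1 / 3).
  { intros z Hz Hmax; assert (H := T_le_third v z ltac:(lra) Hz).
    rewrite Hmax in H.
    assert (Hl := Rmin_l (z - 1 / 3) ((1 - 2 * v) * (z - 1 / 3))).
    assert (Hr := Rmin_r (z - 1 / 3) ((1 - 2 * v) * (z - 1 / 3))).
    nra. }
  destruct (Rle_dec x (1 / 2)) as [Hle | Hgt].
  + left; apply Hhalf; [lra | exact HT].
  + right; enough (1 - x = 1 / 3) by lra.
    apply Hhalf; [lra |]; rewrite T_reflect; exact HT.
- intros [-> | ->]; (split; [lra |]).
  + apply T_third, Hv1.
  + rewrite <- T_reflect.
    replace (1 - 2 / 3) with (1 / 3) by field; apply T_third, Hv1.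
Qed.

(** * The case v = 1/2: self-similarity and block expansions *)

Lemma is_M_half : is_M (1 / 2) (2 / 3).
Proof.
replace (2 / 3) with (1 / (3 * (1 - 1 / 2))) by field; apply is_M_third; lra.
Qed.

(** Passing to 4x - 1 removes a leading block 01. At v = 1/2 the terms linear in x cancel, so each
    block brings the same gain, and m = 1/2 + m/4 gives m = 2/3. *)
Lemma T_half_block01 (x : R) :
  1 / 4 <= x <= 1 / 2 -> T (1 / 2) x = 1 / 2 + T (1 / 2) (4 * x - 1) / 4.
Proof.
intros Hx; rewrite T_fold, T_double by lra.
rewrite <- (T_reflect (1 / 2) (4 * x - 1)).
replace (2 * (1 - 2 * x)) with (1 - (4 * x - 1)) by ring; field.
Qed.

Lemma T_half_block10 (x : R) :
  1 / 2 <= x <= 3 / 4 -> T (1 / 2) x = 1 / 2 + T (1 / 2) (4 * x - 2) / 4.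
Proof.
intros Hx; rewrite <- T_reflect, T_half_block01 by lra.
rewrite <- (T_reflect (1 / 2) (4 * x - 2)).
do 3 f_equal; ring.
Qed.

Lemma E_half_bounds (x : R) : E (1 / 2) x -> 1 / 3 <= x <= 2 / 3.
Proof.
rewrite (E_iff _ _ is_M_half); intros [Hx HT].
assert (Hhalf : forall z, 0 <= z <= 1 / 2 -> T (1 / 2) z = 2 / 3 -> 1 / 3 <= z).
{ intros z Hz Hmax; assert (H := T_le_third (1 / 2) z ltac:(lra) Hz).
  assert (Hl := Rmin_l (z - 1 / 3) ((1 - 2 * (1 / 2)) * (z - 1 / 3))).
  lra. }
destruct (Rle_dec x (1 / 2)) as [Hle | Hgt].
- assert (H := Hhalf x ltac:(lra) HT); lra.
- rewrite <- T_reflect in HT.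
  assert (H := Hhalf (1 - x) ltac:(lra) HT); lra.
Qed.

Lemma E_half_block01 (x : R) : E (1 / 2) x -> x <= 1 / 2 -> E (1 / 2) (4 * x - 1).
Proof.
intros HE Hx; assert (Hb := E_half_bounds x HE).
rewrite (E_iff _ _ is_M_half) in *; destruct HE as [_ HT].
rewrite T_half_block01 in HT by lra; split; lra.
Qed.

Lemma E_half_block10 (x : R) : E (1 / 2) x -> 1 / 2 <= x -> E (1 / 2) (4 * x - 2).
Proof.
intros HE Hx; assert (Hb := E_half_bounds x HE).
rewrite (E_iff _ _ is_M_half) in *; destruct HE as [_ HT].
rewrite T_half_block10 in HT by lra; split; lra.
Qed.

Definition block_expansion (b : nat -> nat) : Prop :=
  forall k : nat,
    (b (2 * k + 1) = 0 /\ b (2 * k + 2) = 1)%nat \/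
    (b (2 * k + 1) = 1 /\ b (2 * k + 2) = 0)%nat.

(** The doubling map modulo 1, except that 1 stays fixed: [0, 1] is preserved and 1 gets the
    expansion 0.111... *)
Fixpoint doubling_orbit (x : R) (n : nat) : R :=
  match n with
  | O => x
  | S m => let y := doubling_orbit x m in
           if Rlt_dec y (1 / 2) then 2 * y else 2 * y - 1
  end.

(* Shifted so that digit [S n] is read off the [n]-th point of the orbit. *)
Definition doubling_digit (x : R) (n : nat) : nat :=
  if Rlt_dec (doubling_orbit x (pred n)) (1 / 2) then 0%nat else 1%nat.

Lemma doubling_orbit_bounds (x : R) :
  0 <= x <= 1 -> forall n : nat, 0 <= doubling_orbit x n <= 1.
Proof.
intros Hx; induction n as [| n IH]; simpl; [exact Hx |].
destruct (Rlt_dec _ _); lra.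
Qed.

(** Each digit term is a difference of consecutive values of (orbit point n) / 2^n, so the sum
    telescopes. *)
Lemma doubling_partial_sum (x : R) (n : nat) :
  sum_n (fun i => INR (doubling_digit x (S i)) / 2 ^ S i) n =
  x - doubling_orbit x (S n) / 2 ^ S n.
Proof.
assert (Hstep : forall i, INR (doubling_digit x (S i)) / 2 ^ S i =
          doubling_orbit x i / 2 ^ i - doubling_orbit x (S i) / 2 ^ S i).
{ intros i; assert (H2 := pow_lt 2 i ltac:(lra)).
  unfold doubling_digit; simpl.
  destruct (Rlt_dec _ _); simpl; field; lra. }
induction n as [| n IH].
- rewrite sum_O, Hstep; simpl; field.
- rewrite sum_Sn, IH, Hstep; unfold plus; simpl; ring.
Qed.

Lemma doubling_expansion (x : R) :
  0 <= x <= 1 -> binary_expansion (doubling_digit x) x.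
Proof.
intros Hx; split.
- intros n _; unfold doubling_digit; destruct (Rlt_dec _ _); auto.
- apply (is_lim_seq_ext
           (fun n => x - doubling_orbit x (S n) / 2 ^ S n) _ (Finite x)).
  { intros n; symmetry; apply doubling_partial_sum. }
  replace (Finite x) with (Finite (x - 0)) by (f_equal; ring).
  apply is_lim_seq_minus'; [apply is_lim_seq_const |].
  apply (is_lim_seq_le_le (fun _ => 0) _ (fun n => (/ 2) ^ S n)).
  + intros n; assert (H := doubling_orbit_bounds x Hx (S n)).
    rewrite pow_inv; unfold Rdiv.
    assert (H2 : 0 < / 2 ^ S n) by (apply Rinv_0_lt_compat, pow_lt; lra).
    nra.
  + apply is_lim_seq_const.
  + apply -> is_lim_seq_incr_1.
    apply is_lim_seq_geom; rewrite Rabs_pos_eq; lra.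
Qed.

(** Two orbit steps remove one block, so the even-indexed orbit points stay maximizers and lie in
    [1/3, 2/3]. Below 1/2 such a point moves to at least 2/3 (digits 01), otherwise to at most 1/3
    (digits 10). *)
Lemma E_half_expansion (x : R) :
  E (1 / 2) x -> binary_expansion (doubling_digit x) x /\
                 block_expansion (doubling_digit x).
Proof.
intros HE; split.
{ apply doubling_expansion; assert (H := E_half_bounds x HE); lra. }
assert (Horb : forall k, E (1 / 2) (doubling_orbit x (2 * k))).
{ induction k as [| k IH]; [exact HE |].
  replace (2 * S k)%nat with (S (S (2 * k))) by lia; simpl.
  set (y := doubling_orbit x (2 * k)) in *.
  change (doubling_orbit x (k + (k + 0))) with y.
  assert (Hb := E_half_bounds y IH).
  destruct (Rlt_dec y (1 / 2)) as [Hy | Hy].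
  - destruct (Rlt_dec (2 * y) (1 / 2)); [lra |].
    replace (2 * (2 * y) - 1) with (4 * y - 1) by ring.
    apply E_half_block01; [exact IH | lra].
  - destruct (Rlt_dec (2 * y - 1) (1 / 2)); [| lra].
    replace (2 * (2 * y - 1)) with (4 * y - 2) by ring.
    apply E_half_block10; [exact IH | lra]. }
intros k; specialize (Horb k); assert (Hb := E_half_bounds _ Horb).
replace (2 * k + 1)%nat with (S (2 * k)) by lia.
replace (2 * k + 2)%nat with (S (S (2 * k))) by lia.
unfold doubling_digit; cbn [pred doubling_orbit].
set (y := doubling_orbit x (2 * k)) in *; cbv zeta.
destruct (Rlt_dec y (1 / 2)) as [Hy | Hy].
- left; destruct (Rlt_dec (2 * y) (1 / 2)); [lra | auto].
- right; destruct (Rlt_dec (2 * y - 1) (1 / 2)); [auto | lra].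
Qed.

Definition block_point (x : R) : Prop :=
  exists b, binary_expansion b x /\ block_expansion b.

Lemma binary_expansion_tail (b : nat -> nat) (x : R) :
  binary_expansion b x ->
  binary_expansion (fun n => b (S n)) (2 * x - INR (b 1%nat)).
Proof.
intros [Hb Hs]; split; [intros n _; apply Hb; lia |].
assert (H : is_series (fun n => INR (b (S (S n))) / 2 ^ S (S n))
              (x - INR (b 1%nat) / 2)).
{ apply (is_series_incr_1 (fun n => INR (b (S n)) / 2 ^ S n)).
  replace (plus (x - INR (b 1%nat) / 2) _) with x; [exact Hs |].
  change (x = x - INR (b 1%nat) / 2 + INR (b 1%nat) / 2 ^ 1); field. }
apply (is_series_scal_l 2) in H.
assert (Heq : 2 * x - INR (b 1%nat) = 2 * (x - INR (b 1%nat) / 2)) by field.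
rewrite Heq; clear Heq.
eapply is_series_ext; [| exact H].
intros n; change (2 * (INR (b (S (S n))) / 2 ^ S (S n)) = INR (b (S (S n))) / 2 ^ S n).
simpl; field; apply pow_nonzero; lra.
Qed.

Lemma binary_expansion_bounds (b : nat -> nat) (x : R) :
  binary_expansion b x -> 0 <= x <= 1.
Proof.
intros [Hb Hs].
assert (Hd : forall n, 0 <= INR (b (S n)) <= 1).
{ intros n; destruct (Hb (S n) ltac:(lia)) as [-> | ->]; simpl; lra. }
assert (Hgeom : is_series (fun n => / 2 * (/ 2) ^ n) 1).
{ assert (Hg : is_series (fun n => (/ 2) ^ n) (/ (1 - / 2))).
  { apply is_series_geom; rewrite Rabs_pos_eq; lra. }
  apply (is_series_scal_l (/ 2)) in Hg.
  assert (H1 : 1 = / 2 * / (1 - / 2)) by field.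
  rewrite H1; exact Hg. }
assert (H2 : forall n, 0 < / 2 ^ S n).
{ intros n; apply Rinv_0_lt_compat, pow_lt; lra. }
rewrite <- (is_series_unique _ _ Hs); split.
- replace 0 with (Series (fun n => 0 * (/ 2) ^ n)).
  + apply Series_le; [| eexists; exact Hs].
    intros n; rewrite Rmult_0_l; split; [lra |].
    apply Rmult_le_pos; [apply Hd | apply Rlt_le, H2].
  + rewrite Series_scal_l; ring.
- rewrite <- (is_series_unique _ _ Hgeom).
  apply Series_le; [| eexists; exact Hgeom].
  intros n; specialize (Hd n); specialize (H2 n).
  replace (/ 2 * (/ 2) ^ n) with (/ 2 ^ S n) by (rewrite <- pow_inv; reflexivity).
  unfold Rdiv; nra.
Qed.

(** Multiplied by 4, the first block 01 or 10 is worth 1 or 2, and the remaining digits again form a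
    block expansion. *)
Lemma block_point_split (x : R) :
  block_point x ->
  0 <= x <= 1 /\ (block_point (4 * x - 1) \/ block_point (4 * x - 2)).
Proof.
intros [b [Hx Hb]]; split; [exact (binary_expansion_bounds b x Hx) |].
assert (Hx2 := binary_expansion_tail _ _ (binary_expansion_tail _ _ Hx)).
assert (Hb2 : block_expansion (fun n => b (S (S n)))).
{ intros k; specialize (Hb (S k)).
  replace (2 * S k + 1)%nat with (S (S (2 * k + 1))) in Hb by lia.
  replace (2 * S k + 2)%nat with (S (S (2 * k + 2))) in Hb by lia.
  exact Hb. }
destruct (Hb 0%nat) as [[H1 H2] | [H1 H2]]; simpl in H1, H2; simpl in Hx2;
  rewrite H1, H2 in Hx2; simpl in Hx2; [left | right];
  (exists (fun n => b (S (S n))); split; [| exact Hb2]).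
- replace (4 * x - 1) with (2 * (2 * x - 0) - 1) by ring; exact Hx2.
- replace (4 * x - 2) with (2 * (2 * x - 1) - 0) by ring; exact Hx2.
Qed.

(** Both 4x - 1 and 4x - 2 enlarge any excess outside [1/3, 2/3] at least fourfold, whence the ratio
    1/4. *)
Lemma block_point_bounds (x : R) : block_point x -> 1 / 3 <= x <= 2 / 3.
Proof.
intros Hx; enough (Rmax (1 / 3 - x) (x - 2 / 3) <= 0).
{ assert (Hl := Rmax_l (1 / 3 - x) (x - 2 / 3)).
  assert (Hr := Rmax_r (1 / 3 - x) (x - 2 / 3)); lra. }
revert x Hx; apply (contraction_le _ _ (1 / 4)); [lra | |].
- exists 1; split; [lra |].
  intros x Hx; apply block_point_split in Hx; apply Rmax_lub; lra.
- intros B HB IH x Hx; apply block_point_split in Hx.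
  destruct Hx as [_ [Hx | Hx]]; specialize (IH _ Hx);
    set (z := 4 * x) in *;
    assert (Hl := Rmax_l (1 / 3 - (z - 1)) (z - 1 - 2 / 3));
    assert (Hr := Rmax_r (1 / 3 - (z - 1)) (z - 1 - 2 / 3));
    assert (Hl' := Rmax_l (1 / 3 - (z - 2)) (z - 2 - 2 / 3));
    assert (Hr' := Rmax_r (1 / 3 - (z - 2)) (z - 2 - 2 / 3));
    subst z; apply Rmax_lub; lra.
Qed.

(** Removing a block multiplies the deficit 2/3 - T by 4, so a bounded deficit cannot be positive.
    The bounds on the tail place x where the block identities apply. *)
Lemma block_point_max (x : R) : block_point x -> T (1 / 2) x = 2 / 3.
Proof.
intros Hx; apply Rle_antisym.
{ apply is_M_half; assert (H := block_point_bounds x Hx); lra. }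
enough (2 / 3 - T (1 / 2) x <= 0) by lra.
revert x Hx; apply (contraction_le _ _ (1 / 4)); [lra | |].
- destruct (T_bounded (1 / 2) ltac:(lra)) as [B [HB HT]].
  exists (B + 2 / 3); split; [lra |].
  intros x _; specialize (HT x).
  assert (H := Rle_abs (- T (1 / 2) x)); rewrite Rabs_Ropp in H; lra.
- intros B HB IH x Hx; apply block_point_split in Hx.
  destruct Hx as [_ [Hx | Hx]]; specialize (IH _ Hx);
    assert (H := block_point_bounds _ Hx).
  + rewrite T_half_block01 by lra; lra.
  + rewrite T_half_block10 by lra; lra.
Qed.

Lemma E_half_iff (x : R) :
  E (1 / 2) x <-> exists b, binary_expansion b x /\ block_expansion b.
Proof.
split; [intros HE; exists (doubling_digit x); apply E_half_expansion, HE |].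
intros Hx; apply (E_iff _ _ is_M_half); split.
- assert (H := block_point_bounds x Hx); lra.
- apply block_point_max, Hx.
Qed.

Lemma block_expansion_sum (b : nat -> nat) :
  block_expansion b <->
  forall k : nat, (b (2 * k + 1) + b (2 * k + 2) = 1)%nat.
Proof.
split; intros H k; specialize (H k); lia.
Qed.

Lemma E_half_third : E (1 / 2) (1 / 3).
Proof.
apply (E_iff _ _ is_M_half); split; [lra |].
rewrite T_third by lra; field.
Qed.

Lemma E_half_two_thirds : E (1 / 2) (2 / 3).
Proof.
apply (E_iff _ _ is_M_half); split; [lra |].
rewrite <- T_reflect; replace (1 - 2 / 3) with (1 / 3) by field.
rewrite T_third by lra; field.
Qed.

(** 5/12 is 0.01 10 10 10..., the largest block expansion beginning with 01. *)
Lemma E_half_five_twelfths : E (1 / 2) (5 / 12).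
Proof.
apply (E_iff _ _ is_M_half); split; [lra |].
rewrite T_half_block01 by lra.
replace (4 * (5 / 12) - 1) with (2 / 3) by field.
destruct (proj1 (E_iff _ _ is_M_half _) E_half_two_thirds) as [_ ->]; field.
Qed.

Lemma Glb_Rbar_min (P : R -> Prop) (m : R) :
  P m -> (forall x, P x -> m <= x) -> Glb_Rbar P = Finite m.
Proof.
intros Hm H; apply is_glb_Rbar_unique; split.
- intros x Hx; apply H, Hx.
- intros b Hb; apply Hb, Hm.
Qed.

Lemma Lub_Rbar_max (P : R -> Prop) (m : R) :
  P m -> (forall x, P x -> x <= m) -> Lub_Rbar P = Finite m.
Proof.
intros Hm H; apply is_lub_Rbar_unique; split.
- intros x Hx; apply H, Hx.
- intros b Hb; apply Hb, Hm.
Qed.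

(** * The range -1/2 <= v <= 1/4, with the maximum at 1/2 *)

Lemma T_le_parabola (v x : R) :
  0 <= v <= 1 / 4 -> 0 <= x <= 1 / 2 -> T v x <= 2 * x * (1 - x).
Proof.
intros Hv Hx; assert (Hv1 : -1 < v < 1) by lra.
enough (T v x - 2 * x * (1 - x) <= 0) by lra.
revert x Hx; apply (contraction_le _ _ v); [lra | |].
- destruct (T_bounded v Hv1) as [B [HB HT]].
  exists B; split; [exact HB |].
  intros x Hx; specialize (HT x); assert (H := Rle_abs (T v x)); nra.
- intros B HB IH x Hx.
  (* The parabola p(x) = 2x(1 - x) satisfies p(x) = x + p(2x)/4, so v <= 1/4 and p(2x) = 4x(1 - 2x)
     >= 0 leave only the error v B. *)
  enough (T v x <= x + v * (B + 4 * x * (1 - 2 * x))).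
  { assert (0 <= 4 * x * (1 - 2 * x)) by nra; nra. }
  destruct (Rle_dec x (1 / 4)) as [Hq | Hq].
  + rewrite T_double by lra.
    assert (H := IH (2 * x) ltac:(lra)); nra.
  + rewrite T_fold by lra.
    assert (H := IH (1 - 2 * x) ltac:(lra)); nra.
Qed.

(** In the two-step recursion the affine parts are (1 + 2v)x and 1/2 - (1 - 2v)d with d <= 1/4; both
    are nonnegative because v >= -1/2. *)
Lemma T_nonneg (v x : R) :
  - (1 / 2) <= v <= 0 -> 0 <= x <= 1 -> 0 <= T v x.
Proof.
intros Hv Hx; assert (Hv1 : -1 < v < 1) by lra.
enough (- T v x <= 0) by lra.
revert x Hx; apply (contraction_le _ _ (v ^ 2)); [nra | |].
- destruct (T_bounded v Hv1) as [B [HB HT]].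
  exists B; split; [exact HB |].
  intros x _; specialize (HT x).
  assert (H := Rle_abs (- T v x)); rewrite Rabs_Ropp in H; lra.
- intros B HB IH.
  assert (Hhalf : forall x, 0 <= x <= 1 / 2 -> - T v x <= v ^ 2 * B).
  { intros x Hx; assert (Hsq : 0 <= v ^ 2) by nra.
    destruct (Rle_dec x (1 / 4)) as [Hq | Hq].
    - rewrite T_quad_low by lra.
      assert (H := IH (4 * x) ltac:(lra)); nra.
    - replace x with (1 / 2 - (1 / 2 - x)) by ring.
      rewrite T_quad_high by lra.
      assert (H := IH (4 * (1 / 2 - x)) ltac:(lra)); nra. }
  intros x Hx; destruct (Rle_dec x (1 / 2)) as [Hle | Hgt].
  + apply Hhalf; lra.
  + rewrite <- T_reflect; apply Hhalf; lra.
Qed.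

Lemma maximizers_middle (v : R) :
  - (1 / 2) <= v <= 1 / 4 ->
  (forall x : R, E v x <-> x = 1 / 2) /\ is_M v (1 / 2).
Proof.
intros Hv; assert (Hv1 : -1 < v < 1) by lra.
assert (Hlt : forall x, 0 <= x < 1 / 2 -> T v x < 1 / 2).
{ intros x Hx; destruct (Rle_dec 0 v) as [H0 | H0].
  - assert (H := T_le_parabola v x ltac:(lra) ltac:(lra)); nra.
  - rewrite T_double by lra.
    assert (H := T_nonneg v (2 * x) ltac:(lra) ltac:(lra)); nra. }
assert (HM : is_M v (1 / 2)).
{ apply (is_M_intro v _ (1 / 2)); [exact Hv1 | lra | apply T_at_half, Hv1 |].
  intros x Hx; destruct (Req_dec x (1 / 2)) as [-> | Hne].
  - rewrite T_at_half; lra.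
  - apply Rlt_le, Hlt; lra. }
split; [| exact HM].
intros x; rewrite (E_iff _ _ HM); split.
- intros [Hx HT]; destruct (Rtotal_order x (1 / 2)) as [H | [H | H]]; [| exact H |].
  + assert (H1 := Hlt x ltac:(lra)); lra.
  + assert (H1 := Hlt (1 - x) ltac:(lra)); rewrite T_reflect in H1; lra.
- intros ->; split; [lra | apply T_at_half, Hv1].
Qed.

(** * The range -1 < v < -1/2, written as v = -y/2 *)

Section NegativeParameter.

Variable y : R.
Hypothesis Hy : 1 < y < 2.

Let f := T (- y / 2).
Let c := f (2 / 5).

Let Hv : -1 < - y / 2 < 1.
Proof. lra. Qed.

Lemma neg_low (x : R) :
  0 <= x <= 1 / 4 -> f x = (1 - y) * x + y ^ 2 / 4 * f (4 * x).
Proof.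
intros Hx; unfold f; rewrite T_quad_low by assumption; field.
Qed.

Lemma neg_high (d : R) :
  0 <= d <= 1 / 4 -> f (1 / 2 - d) = 1 / 2 - (1 + y) * d + y ^ 2 / 4 * f (4 * d).
Proof.
intros Hd; unfold f; rewrite T_quad_high by assumption; field.
Qed.

Lemma neg_reflect (x : R) : f (1 - x) = f x.
Proof. apply T_reflect. Qed.

(** With d = 1/10 both 1/2 - d and 4d equal 2/5, so [neg_high] becomes a linear equation for [c]. *)
Lemma neg_two_fifths : (4 - y ^ 2) * c = 2 * (4 - y) / 5.
Proof.
assert (H := neg_high (1 / 10) ltac:(lra)).
replace (1 / 2 - 1 / 10) with (2 / 5) in H by field.
replace (4 * (1 / 10)) with (2 / 5) in H by field.
fold c in H; lra.
Qed.

Lemma neg_high_centered (x : R) :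
  1 / 4 <= x <= 1 / 2 ->
  f x - c = (1 + y) * (x - 2 / 5) + y ^ 2 / 4 * (f (2 - 4 * x) - c).
Proof.
intros Hx; assert (H := neg_high (1 / 2 - x) ltac:(lra)).
replace (1 / 2 - (1 / 2 - x)) with x in H by ring.
replace (4 * (1 / 2 - x)) with (2 - 4 * x) in H by field.
assert (Hc := neg_two_fifths); lra.
Qed.

(* The slopes 1 and 1/y bound the tilts for which the maximum of
   [f x - lambda * x] sits at 2/5; the contraction step preserves the bound. *)
Lemma neg_majorant (x : R) :
  0 <= x <= 1 -> f x <= c + Rmin (x - 2 / 5) ((x - 2 / 5) / y).
Proof.
intros Hx.
set (i := / y); assert (Hi : i * y = 1) by (apply Rinv_l; lra).
assert (Hi1 : 1 / 2 < i < 1) by (split; nra).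
set (h := fun x => Rmin (x - 2 / 5) ((x - 2 / 5) / y)).
assert (Hh1 : forall z, h z <= z - 2 / 5) by (intros z; apply Rmin_l).
assert (Hh2 : forall z, h z <= (z - 2 / 5) * i) by (intros z; apply Rmin_r).
assert (Hlow : forall z, z <= 2 / 5 -> h z = z - 2 / 5).
{ intros z Hz; unfold h, Rdiv; fold i; apply Rmin_left; nra. }
assert (Hhigh : forall z, 2 / 5 <= z -> h z = (z - 2 / 5) * i).
{ intros z Hz; unfold h, Rdiv; fold i; apply Rmin_right; nra. }
enough (f x - c - h x <= 0) by (unfold h in *; lra).
revert x Hx; apply (contraction_le _ _ (y ^ 2 / 4)); [nra | |].
- destruct (T_bounded _ Hv) as [B [HB HT]].
  exists (B + Rabs c + 2); split; [assert (Hp := Rabs_pos c); lra |].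
  intros x Hx.
  assert (H1 := Rle_abs (f x)); specialize (HT x); fold f in HT.
  assert (H2 := Rle_abs (- c)); rewrite Rabs_Ropp in H2.
  assert (H4 : - 2 <= h x).
  { destruct (Rle_dec x (2 / 5)); [rewrite Hlow | rewrite Hhigh]; nra. }
  lra.
- intros B HB IH.
  assert (Hhalf : forall x, 0 <= x <= 1 / 2 -> f x - c - h x <= y ^ 2 / 4 * B).
  { intros x Hx; assert (Hq : 0 < y ^ 2 / 4 < 1) by nra.
    destruct (Rle_dec x (1 / 4)) as [Hx4 | Hx4].
    (* The bound of slope 1/y at 4x gives the slope (1 - y) + y = 1. *)
    - rewrite Hlow by lra; rewrite neg_low by lra.
      assert (H := IH (4 * x) ltac:(lra)).
      assert (H2 := Hh2 (4 * x)).
      assert (Hc := neg_two_fifths).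
      assert (H3 : y ^ 2 / 4 * f (4 * x) <=
                   y ^ 2 / 4 * (c + (4 * x - 2 / 5) * i + B)).
      { apply Rmult_le_compat_l; lra. }
      replace (y ^ 2 / 4 * (c + (4 * x - 2 / 5) * i + B)) with
        (y ^ 2 / 4 * c + y * (i * y) * (x - 1 / 10) + y ^ 2 / 4 * B) in H3 by field.
      rewrite Hi in H3; lra.
    - rewrite neg_high_centered by lra.
      assert (H := IH (2 - 4 * x) ltac:(lra)).
      destruct (Rle_dec x (2 / 5)) as [Hx5 | Hx5].
      + rewrite Hlow by lra.
        assert (H2 := Hh2 (2 - 4 * x)).
        assert (H3 : y ^ 2 / 4 * (f (2 - 4 * x) - c) <=
                     y ^ 2 / 4 * ((2 - 4 * x - 2 / 5) * i + B)).
        { apply Rmult_le_compat_l; lra. }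
        replace (y ^ 2 / 4 * ((2 - 4 * x - 2 / 5) * i + B)) with
          (y * (i * y) * (2 / 5 - x) + y ^ 2 / 4 * B) in H3 by field.
        rewrite Hi in H3; lra.
      (* Here 2 - 4x < 2/5, where [h] has slope 1; the resulting slope 1 + y - y^2 is at most
         1/y. *)
      + rewrite Hhigh by lra.
        rewrite Hlow in H by lra.
        assert (H3 : y ^ 2 / 4 * (f (2 - 4 * x) - c) <=
                     y ^ 2 / 4 * (2 - 4 * x - 2 / 5 + B)).
        { apply Rmult_le_compat_l; lra. }
        assert (Hs : 1 + y - y ^ 2 <= i) by nra.
        nra. }
  intros x Hx; destruct (Rle_dec x (1 / 2)) as [Hle | Hgt].
  + apply Hhalf; lra.
  + assert (H := Hhalf (1 - x) ltac:(lra)).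
    rewrite neg_reflect in H.
    enough (h (1 - x) <= h x) by lra.
    rewrite (Hhigh x) by lra.
    specialize (Hh2 (1 - x)); nra.
Qed.

Lemma neg_le_slope1 (x : R) : 0 <= x <= 1 -> f x <= c + (x - 2 / 5).
Proof.
intros Hx; eapply Rle_trans; [apply neg_majorant, Hx |].
apply Rplus_le_compat_l, Rmin_l.
Qed.

Lemma neg_le_slope_inv (x : R) : 0 <= x <= 1 -> f x <= c + (x - 2 / 5) / y.
Proof.
intros Hx; eapply Rle_trans; [apply neg_majorant, Hx |].
apply Rplus_le_compat_l, Rmin_r.
Qed.

(** Below 2/5 the slope-1 bound is strictly better since 1/y < 1; between 2/5 and 1/2 one more
    recursion gives the smaller slope 1 + y - y^2; beyond 1/2 reflection wins. *)
Lemma neg_lt_slope_inv (x : R) :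
  0 <= x <= 1 -> x <> 2 / 5 -> f x < c + (x - 2 / 5) / y.
Proof.
set (i := / y); assert (Hi : i * y = 1) by (apply Rinv_l; lra).
assert (Hi1 : 1 / 2 < i < 1) by (split; nra).
assert (Hhalf : forall z, 0 <= z <= 1 / 2 -> z <> 2 / 5 ->
          f z < c + (z - 2 / 5) * i).
{ intros z Hz Hne; destruct (Rle_dec z (2 / 5)) as [Hle | Hgt].
  - assert (H := neg_le_slope1 z ltac:(lra)); nra.
  - assert (H := neg_high_centered z ltac:(lra)).
    assert (H1 := neg_le_slope1 (2 - 4 * z) ltac:(lra)).
    assert (H3 : y ^ 2 / 4 * (f (2 - 4 * z) - c) <=
                 y ^ 2 / 4 * (2 - 4 * z - 2 / 5)).
    { apply Rmult_le_compat_l; [nra | lra]. }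
    (* [y (1 + y - y^2) < 1] is [(y - 1)^2 (y + 1) > 0]. *)
    assert (Hs : 1 + y - y ^ 2 < i).
    { apply (Rmult_lt_reg_r y); [lra | rewrite Hi].
      assert (0 < (y - 1) ^ 2 * (y + 1)); [| nra].
      apply Rmult_lt_0_compat; [apply pow_lt |]; lra. }
    nra. }
intros Hx Hne; unfold Rdiv; fold i.
destruct (Rle_dec x (1 / 2)) as [Hle | Hgt]; [apply Hhalf; lra |].
assert (H := neg_le_slope_inv (1 - x) ltac:(lra)).
rewrite neg_reflect in H; unfold Rdiv in H; fold i in H; nra.
Qed.

(** Below 2/5 the slope-1 bound comes from the slope-1/y bound at 4x or 2 - 4x, so equality forces
    that point to be 2/5. The contact at 1/10 causes the extra maximizers at the thresholds. *)
Lemma neg_eq_slope1 (x : R) :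
  0 <= x <= 1 -> f x = c + (x - 2 / 5) -> x = 2 / 5 \/ x = 1 / 10.
Proof.
set (i := / y); assert (Hi : i * y = 1) by (apply Rinv_l; lra).
assert (Hi1 : 1 / 2 < i < 1) by (split; nra).
assert (Hc := neg_two_fifths).
intros Hx Heq; destruct (Rle_dec x (2 / 5)) as [Hle | Hgt].
2: { assert (H := neg_le_slope_inv x Hx); unfold Rdiv in H; fold i in H; nra. }
destruct (Req_dec x (2 / 5)) as [H | Hne5]; [left; exact H | right].
destruct (Rle_dec x (1 / 4)) as [Hx4 | Hx4].
- destruct (Req_dec x (1 / 10)) as [H | Hne]; [exact H | exfalso].
  rewrite neg_low in Heq by lra.
  assert (H := neg_lt_slope_inv (4 * x) ltac:(lra) ltac:(lra)).
  replace ((4 * x - 2 / 5) / y) with ((4 * x - 2 / 5) * i) in H by reflexivity.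
  assert (H3 : y ^ 2 / 4 * f (4 * x) < y ^ 2 / 4 * (c + (4 * x - 2 / 5) * i)).
  { apply Rmult_lt_compat_l; [nra | exact H]. }
  replace (y ^ 2 / 4 * (c + (4 * x - 2 / 5) * i)) with
    (y ^ 2 / 4 * c + y * (i * y) * (x - 1 / 10)) in H3 by field.
  rewrite Hi in H3; lra.
- exfalso; assert (H := neg_high_centered x ltac:(lra)).
  assert (H1 := neg_lt_slope_inv (2 - 4 * x) ltac:(lra) ltac:(lra)).
  replace ((2 - 4 * x - 2 / 5) / y) with ((2 - 4 * x - 2 / 5) * i) in H1
    by reflexivity.
  assert (H3 : y ^ 2 / 4 * (f (2 - 4 * x) - c) <
               y ^ 2 / 4 * ((2 - 4 * x - 2 / 5) * i)).
  { apply Rmult_lt_compat_l; [nra | lra]. }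
  replace (y ^ 2 / 4 * ((2 - 4 * x - 2 / 5) * i)) with
    (y * (i * y) * (2 / 5 - x)) in H3 by field.
  rewrite Hi in H3; lra.
Qed.

(** * Comparison of the scales 4^-j near 1/2 *)

Lemma neg_tenth : f (1 / 10) = c - 3 / 10.
Proof.
rewrite neg_low by lra.
replace (4 * (1 / 10)) with (2 / 5) by field.
assert (Hc := neg_two_fifths); fold c; lra.
Qed.

(* Among points approaching 1/2 at scale 4^-j, maximizing [f] amounts to
   maximizing [f u - tilt j * u]. *)
Definition tilt (j : nat) : R := (1 + (1 + 2 * y) / y ^ (2 * j)) / (1 + y).

Let Hpow (j : nat) : 0 < y ^ (2 * j).
Proof. apply pow_lt; lra. Qed.

(** One use of [neg_high] and j of [neg_low]: the coefficients 1 + y and (y - 1) y^(2i), for i = 1,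
    ..., j, sum geometrically. *)
Lemma neg_near_half (j : nat) (d : R) :
  0 <= d -> 4 ^ j * d <= 1 / 4 ->
  f (1 / 2 - d) = 1 / 2 - (1 + 2 * y + y ^ (2 * S j)) / (1 + y) * d
                  + (y ^ 2 / 4) ^ S j * f (4 ^ S j * d).
Proof.
intros Hd; induction j as [| j IH]; intros Hj.
- rewrite neg_high by (simpl in Hj; lra).
  rewrite !pow_1, pow_mult, pow_1; field; lra.
- assert (H4 := pow_lt 4 j ltac:(lra)).
  assert (Hj' : 4 * (4 ^ j * d) <= 1 / 4) by (simpl in Hj; lra).
  assert (Hpos : 0 <= 4 ^ j * d) by (apply Rmult_le_pos; lra).
  rewrite IH by lra.
  replace (f (4 ^ S j * d)) with
    ((1 - y) * (4 ^ S j * d) + y ^ 2 / 4 * f (4 * (4 ^ S j * d)))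
    by (symmetry; apply neg_low; simpl; lra).
  replace (4 * (4 ^ S j * d)) with (4 ^ S (S j) * d) by (simpl; ring).
  replace (2 * S (S j))%nat with (2 + 2 * S j)%nat by lia.
  rewrite pow_add, (pow_mult y 2 (S j)).
  rewrite (Rmult_plus_distr_l ((y ^ 2 / 4) ^ S j)).
  replace ((y ^ 2 / 4) ^ S j * ((1 - y) * (4 ^ S j * d)))
    with ((1 - y) * (y ^ 2) ^ S j * d).
  + rewrite <- (tech_pow_Rmult (y ^ 2 / 4) (S j)); field; lra.
  + unfold Rdiv; rewrite (Rpow_mult_distr (y ^ 2)), pow_inv; field.
    apply pow_nonzero; lra.
Qed.

Lemma neg_near_half_tilt (j : nat) (d : R) :
  0 <= d -> 4 ^ j * d <= 1 / 4 ->
  f (1 / 2 - d) =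
  1 / 2 + (y ^ 2 / 4) ^ S j * (f (4 ^ S j * d) - tilt (S j) * (4 ^ S j * d)).
Proof.
intros Hd Hj; rewrite (neg_near_half j d Hd Hj).
assert (Hp := Hpow (S j)); assert (H4 := pow_lt 4 (S j) ltac:(lra)).
unfold tilt; rewrite pow_mult in *.
replace ((y ^ 2 / 4) ^ S j) with ((y ^ 2) ^ S j / 4 ^ S j)
  by (unfold Rdiv; rewrite Rpow_mult_distr, pow_inv; reflexivity).
field; lra.
Qed.

Lemma tilt_decr (i j : nat) : (i < j)%nat -> tilt j < tilt i.
Proof.
intros Hij; unfold tilt, Rdiv.
apply Rmult_lt_compat_r; [apply Rinv_0_lt_compat; lra |].
apply Rplus_lt_compat_l, Rmult_lt_compat_l; [lra |].
apply Rinv_lt_contravar; [apply Rmult_lt_0_compat; apply Hpow |].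
apply Rlt_pow; [lra | lia].
Qed.

Lemma tilt_le_1 (j : nat) : 1 + 2 * y <= y ^ (2 * j + 1) -> tilt j <= 1.
Proof.
intros H; assert (Hp := Hpow j); unfold tilt.
replace (2 * j + 1)%nat with (S (2 * j)) in H by lia.
rewrite <- tech_pow_Rmult in H.
apply Rle_div_l; [lra |].
enough ((1 + 2 * y) / y ^ (2 * j) <= y) by lra.
apply Rle_div_l; [exact Hp | lra].
Qed.

Lemma tilt_eq_1 (j : nat) : tilt j = 1 -> y ^ (2 * j + 1) = 1 + 2 * y.
Proof.
intros H; assert (Hp := Hpow j); unfold tilt in H.
replace (2 * j + 1)%nat with (S (2 * j)) by lia.
rewrite <- tech_pow_Rmult.
apply (f_equal (fun t => t * ((1 + y) * y ^ (2 * j)))) in H.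
field_simplify in H; lra.
Qed.

Lemma tilt_1_eq (j : nat) : y ^ (2 * j + 1) = 1 + 2 * y -> tilt j = 1.
Proof.
intros H; assert (Hp := Hpow j); unfold tilt.
replace (2 * j + 1)%nat with (S (2 * j)) in H by lia.
rewrite <- tech_pow_Rmult in H.
rewrite <- H; field; lra.
Qed.

(** Cleared of denominators, 1/y < tilt (S j) and 1 < tilt j are the same inequality, so the window
    (1/y, 1] opens for S j exactly when j leaves it. *)
Lemma tilt_gt_inv (j : nat) : y ^ (2 * j + 1) < 1 + 2 * y -> / y < tilt (S j).
Proof.
intros H; assert (Hp := Hpow j); unfold tilt.
replace (2 * j + 1)%nat with (S (2 * j)) in H by lia.
rewrite <- tech_pow_Rmult in H.
replace (2 * S j)%nat with (S (S (2 * j))) by lia.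
rewrite <- 2!tech_pow_Rmult.
apply Rlt_div_r; [lra |].
replace (/ y * (1 + y)) with (1 + / y) by (field; lra).
apply Rplus_lt_compat_l.
apply Rlt_div_r; [repeat apply Rmult_lt_0_compat; lra |].
replace (/ y * (y * (y * y ^ (2 * j)))) with (y * y ^ (2 * j)) by (field; lra).
exact H.
Qed.

Lemma tilt_gt_1 (j : nat) : y ^ (2 * j + 1) < 1 + 2 * y -> 1 < tilt j.
Proof.
intros H; assert (Hp := Hpow j); unfold tilt.
replace (2 * j + 1)%nat with (S (2 * j)) in H by lia.
rewrite <- tech_pow_Rmult in H.
apply Rlt_div_r; [lra |].
enough (y < (1 + 2 * y) / y ^ (2 * j)) by lra.
apply Rlt_div_r; [exact Hp | lra].
Qed.

(** The tilt lies between the two slopes of the majorant, so its corner 2/5 is the maximum; at lam =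
    1 the left branch becomes flat and 1/10 ties. *)
Lemma tilted_max (lam u : R) :
  / y < lam <= 1 -> 0 <= u <= 1 ->
  f u - lam * u <= c - lam * (2 / 5) /\
  (f u - lam * u = c - lam * (2 / 5) -> u = 2 / 5 \/ lam = 1 /\ u = 1 / 10).
Proof.
intros Hlam Hu.
assert (H1 := neg_le_slope1 u Hu).
assert (H2 := neg_le_slope_inv u Hu); unfold Rdiv in H2 at 2.
split; [destruct (Rle_dec u (2 / 5)); nra |].
intros Heq; destruct (Req_dec lam 1) as [-> | Hne].
- destruct (neg_eq_slope1 u Hu ltac:(lra)); auto.
- left; destruct (Rtotal_order u (2 / 5)) as [H | [H | H]]; [| exact H |];
    exfalso; nra.
Qed.

(** The offset that 4^k rescales to the contact point 2/5; the next offset is rescaled to the other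
    contact point 1/10. *)
Definition delta (k : nat) : R := 2 / 5 / 4 ^ k.

Lemma delta_scale (k : nat) : 4 ^ k * delta k = 2 / 5.
Proof. unfold delta; field; apply pow_nonzero; lra. Qed.

Lemma delta_scale_pred (k : nat) : 4 ^ k * delta (S k) = 1 / 10.
Proof. unfold delta; simpl; field; apply pow_nonzero; lra. Qed.

Lemma delta_pos (k : nat) : 0 <= delta k.
Proof.
apply Rlt_le; unfold delta.
apply Rdiv_lt_0_compat; [lra | apply pow_lt; lra].
Qed.

Lemma scale_cancel (k : nat) (d d' : R) : 4 ^ k * d = 4 ^ k * d' -> d = d'.
Proof.
intros H; apply (Rmult_eq_reg_l (4 ^ k)); [exact H | apply pow_nonzero; lra].
Qed.

Lemma neg_at_delta (k : nat) :
  f (1 / 2 - delta (S k)) =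
  1 / 2 + (y ^ 2 / 4) ^ S k * (c - tilt (S k) * (2 / 5)).
Proof.
rewrite (neg_near_half_tilt k), delta_scale;
  [reflexivity | apply delta_pos | rewrite delta_scale_pred; lra].
Qed.

(** Seen at the coarser scale, the next candidate exceeds the one in [neg_at_delta] by a positive
    multiple of tilt (S k) - 1, so the two tie exactly at tilt 1. *)
Lemma neg_at_next_delta (k : nat) :
  f (1 / 2 - delta (S (S k))) =
  1 / 2 + (y ^ 2 / 4) ^ S k * (c - 3 / 10 - tilt (S k) * (1 / 10)).
Proof.
rewrite (neg_near_half_tilt k), delta_scale_pred, neg_tenth;
  [reflexivity | apply delta_pos |].
replace (4 ^ k * delta (S (S k))) with (4 ^ S k * delta (S (S k)) / 4)
  by (simpl; field).
rewrite delta_scale_pred; lra.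
Qed.

Section Level.

(* The level of the theorem is [S k]. *)
Variable k : nat.
Hypothesis Hk1 : y ^ (2 * k + 1) < 1 + 2 * y.
Hypothesis Hk2 : 1 + 2 * y <= y ^ (2 * S k + 1).

(* Downward induction on the scale [S j = S k - n]: coarser scales have tilt
   above 1, so they are beaten by the next finer one. *)
Lemma neg_max_at_scale (n j : nat) (d : R) :
  (j + n = k)%nat -> 0 <= d -> 4 ^ j * d <= 1 / 4 ->
  f (1 / 2 - d) <= f (1 / 2 - delta (S k)) /\
  (f (1 / 2 - d) = f (1 / 2 - delta (S k)) ->
   d = delta (S k) \/ (tilt (S k) = 1 /\ d = delta (S (S k)))).
Proof.
revert j d; induction n as [| n IH]; intros j d Hj Hd Hs.
- replace j with k in * by lia.
  assert (Hs0 : 0 <= 4 ^ k * d) by (apply Rmult_le_pos; [apply pow_le |]; lra).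
  assert (Hq : 0 < (y ^ 2 / 4) ^ S k) by (apply pow_lt; nra).
  rewrite neg_at_delta, (neg_near_half_tilt k d Hd Hs).
  destruct (tilted_max (tilt (S k)) (4 ^ S k * d)) as [H1 H2].
  + split; [apply tilt_gt_inv, Hk1 | apply tilt_le_1, Hk2].
  + simpl; lra.
  + split; [nra |].
    intros Heq.
    destruct H2 as [H2 | [Ht H2]]; [nra | left | right; split; [exact Ht |]];
      apply (scale_cancel (S k)).
    * rewrite delta_scale; exact H2.
    * rewrite delta_scale_pred; exact H2.
- destruct (Rle_dec (4 ^ S j * d) (1 / 4)) as [Hle | Hgt].
  { apply (IH (S j)); [lia | exact Hd | exact Hle]. }
  assert (Htilt : 1 < tilt (S j)).
  { assert (Ht := tilt_gt_1 k Hk1).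
    destruct (Nat.eq_dec (S j) k) as [-> | Hne]; [exact Ht |].
    assert (H := tilt_decr (S j) k ltac:(lia)); lra. }
  assert (Hnext : f (1 / 2 - delta (S (S j))) <= f (1 / 2 - delta (S k))).
  { apply (IH (S j)); [lia | apply delta_pos | rewrite delta_scale_pred; lra]. }
  assert (Hq : 0 < (y ^ 2 / 4) ^ S j) by (apply pow_lt; nra).
  enough (f (1 / 2 - d) < f (1 / 2 - delta (S (S j)))) by (split; lra).
  rewrite neg_at_next_delta, (neg_near_half_tilt j d Hd Hs).
  assert (Hu : 1 / 4 < 4 ^ S j * d <= 1) by (simpl; simpl in Hgt; lra).
  assert (H := neg_le_slope1 (4 ^ S j * d) ltac:(lra)).
  apply Rplus_lt_compat_l, Rmult_lt_compat_l; [exact Hq |].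
  (* With t the tilt and u the rescaled offset, this is (t - 1)(u - 1/10) > 0. *)
  nra.
Qed.

Lemma neg_max_half (x : R) :
  0 <= x <= 1 / 2 ->
  f x <= f (1 / 2 - delta (S k)) /\
  (f x = f (1 / 2 - delta (S k)) ->
   x = 1 / 2 - delta (S k) \/ (tilt (S k) = 1 /\ x = 1 / 2 - delta (S (S k)))).
Proof.
intros Hx; destruct (Rle_dec (1 / 4) x) as [Hge | Hlt].
- destruct (neg_max_at_scale k 0 (1 / 2 - x)) as [H1 H2];
    [lia | lra | simpl; lra |].
  replace (1 / 2 - (1 / 2 - x)) with x in H1, H2 by ring.
  split; [exact H1 |].
  intros Heq; destruct (H2 Heq) as [H | [Ht H]]; [left | right; split]; lra.
(* Points below 1/4 are strictly beaten by 2/5 = 1/2 - 1/10, which scale 0 covers. *)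
- destruct (neg_max_at_scale k 0 (1 / 10)) as [H1 _];
    [lia | lra | simpl; lra |].
  replace (1 / 2 - 1 / 10) with (2 / 5) in H1 by field; fold c in H1.
  assert (H := neg_le_slope1 x ltac:(lra)); split; lra.
Qed.

Lemma neg_is_M : is_M (- y / 2) (f (1 / 2 - delta (S k))).
Proof.
apply (is_M_intro _ _ (1 / 2 - delta (S k))); [exact Hv | | reflexivity |].
- assert (H := delta_pos (S k)); split; [| lra].
  assert (H4 : 1 <= 4 ^ k) by (apply pow_R1_Rle; lra).
  assert (H1 := delta_scale_pred k); nra.
- intros x Hx; apply neg_max_half, Hx.
Qed.

Lemma neg_maximizers (x : R) :
  E (- y / 2) x <->
  (x = 1 / 2 - delta (S k) \/ x = 1 / 2 + delta (S k)) \/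
  (tilt (S k) = 1 /\
   (x = 1 / 2 - delta (S (S k)) \/ x = 1 / 2 + delta (S (S k)))).
Proof.
assert (Hd : forall j, 0 <= delta (S j) <= 1 / 10).
{ intros j; split; [apply delta_pos |].
  assert (H4 : 1 <= 4 ^ j) by (apply pow_R1_Rle; lra).
  assert (H0 := delta_pos (S j)); assert (H1 := delta_scale_pred j); nra. }
assert (Hplus : forall d, f (1 / 2 + d) = f (1 / 2 - d)).
{ intros d; rewrite <- neg_reflect; f_equal; field. }
rewrite (E_iff _ _ neg_is_M); split.
- intros [Hx HT]; fold f in HT.
  destruct (Rle_dec x (1 / 2)) as [Hle | Hgt].
  + destruct (neg_max_half x ltac:(lra)) as [_ H].
    destruct (H HT) as [H1 | [Ht H1]]; auto.
  + rewrite <- neg_reflect in HT.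
    destruct (neg_max_half (1 - x) ltac:(lra)) as [_ H].
    destruct (H HT) as [H1 | [Ht H1]];
      [left; right | right; split; [exact Ht | right]]; lra.
- assert (Hk := Hd k); assert (HSk := Hd (S k)).
  intros [[-> | ->] | [Ht [-> | ->]]]; (split; [lra |]); fold f;
    rewrite ?Hplus; try reflexivity;
    rewrite (neg_at_delta k), (neg_at_next_delta k), Ht; do 2 f_equal; lra.
Qed.

End Level.

End NegativeParameter.

(** * The thresholds: negative roots of [Ptilde (2 * k)], their order and asymptotics *)

Lemma Ptilde_closed_form (n : nat) (x : R) :
  (1 - 2 * x) * Ptilde (2 * n) x = 1 - 4 * x - (-2 * x) ^ (2 * n + 1).
Proof.
unfold Ptilde; induction n as [| n IH].
- rewrite sum_n_m_zero by lia; unfold zero; simpl; ring.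
- replace (2 * S n)%nat with (S (S (2 * n))) by lia.
  rewrite !sum_n_Sm by lia; unfold plus; simpl (AbelianMonoid.plus _ _).
  rewrite <- !Rpow_mult_distr.
  replace (S (S (2 * n)) + 1)%nat with (S (S (2 * n + 1))) by lia.
  replace (2 * n + 1)%nat with (S (2 * n)) in * by lia.
  assert (He : (-2 * x) ^ (2 * n) = (2 * x) ^ (2 * n)).
  { rewrite !pow_mult; f_equal; ring. }
  rewrite <- !tech_pow_Rmult in *; rewrite He in *.
  lra.
Qed.

(** Divided by b, the hypothesis reads b^n <= 2 + 1/b; passing to a < b does not increase the left
    side and strictly increases the right. *)
Lemma root_order (n : nat) (a b : R) :
  0 < a < b -> b ^ S n <= 1 + 2 * b -> a ^ S n < 1 + 2 * a.
Proof.
intros Hab Hb; rewrite <- tech_pow_Rmult in *.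
assert (Hp : a ^ n <= b ^ n) by (apply pow_incr; lra).
assert (Ha : 0 < a ^ n) by (apply pow_lt; lra).
apply (Rmult_lt_reg_r b); [lra |].
assert (a * (b * a ^ n) <= a * (b * b ^ n)).
{ apply Rmult_le_compat_l; [lra |]; apply Rmult_le_compat_l; lra. }
nra.
Qed.

(** The difference of the sides is -2 at 1 and 2^(2k+1) - 5 > 0 at 2. The informative existential
    lets [vs] project the root. *)
Lemma root_exists (k : nat) :
  (1 <= k)%nat -> {y : R | 1 < y < 2 /\ y ^ (2 * k + 1) = 1 + 2 * y}.
Proof.
intros Hk.
assert (H2 : 5 < 2 ^ (2 * k + 1)).
{ apply (Rlt_le_trans _ (2 ^ 3)); [simpl; lra |].
  apply Rle_pow; [lra | lia]. }
destruct (IVT (fun y => y ^ (2 * k + 1) - (1 + 2 * y)) 1 2) as [y [Hy H0]].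
- apply continuity_minus; [apply derivable_continuous, derivable_pow |].
  apply continuity_plus; [apply continuity_const; intros a b; reflexivity |].
  apply continuity_mult; [apply continuity_const; intros a b; reflexivity |].
  apply derivable_continuous, derivable_id.
- lra.
- rewrite pow1; lra.
- lra.
- exists y; split; [| lra].
  assert (y <> 1) by (intros ->; rewrite pow1 in H0; lra).
  assert (y <> 2) by (intros ->; lra).
  lra.
Qed.

(* The root is encoded as [vs k = - y / 2] with [y ^ (2k+1) = 1 + 2y]. *)
Definition vs (k : nat) : R :=
  match k with
  | O => -1
  | S n => - proj1_sig (root_exists (S n) (le_n_S 0 n (Nat.le_0_l n))) / 2
  end.

Lemma vs_spec (k : nat) :
  (1 <= k)%nat ->
  exists y : R, vs k = - y / 2 /\ 1 < y < 2 /\ y ^ (2 * k + 1) = 1 + 2 * y.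
Proof.
intros Hk; destruct k as [| n]; [lia |].
unfold vs; destruct (root_exists _ _) as [y Hy]; exists y; auto.
Qed.

Lemma vs_unique_root (k : nat) :
  (1 <= k)%nat -> unique (fun x : R => x < 0 /\ Ptilde (2 * k) x = 0) (vs k).
Proof.
intros Hk; destruct (vs_spec k Hk) as [y [-> [Hy Hroot]]]; split.
- split; [lra |].
  assert (H := Ptilde_closed_form k (- y / 2)).
  replace (-2 * (- y / 2)) with y in H by field.
  apply (Rmult_eq_reg_l (1 - 2 * (- y / 2))); lra.
- intros x [Hx H0].
  assert (H := Ptilde_closed_form k x); rewrite H0 in H.
  set (z := -2 * x) in *; replace x with (- z / 2) in * by (unfold z; field).
  enough (y = z) by lra.
  replace (2 * k + 1)%nat with (S (2 * k)) in * by lia.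
  destruct (Rtotal_order y z) as [Hlt | [Heq | Hgt]]; [| exact Heq |].
  + assert (H1 := root_order (2 * k) y z ltac:(lra) ltac:(lra)); lra.
  + assert (H1 := root_order (2 * k) z y ltac:(lra) ltac:(lra)); lra.
Qed.

Lemma vs_bounds (k : nat) : (1 <= k)%nat -> -1 < vs k < - (1 / 2).
Proof. intros Hk; destruct (vs_spec k Hk) as [y [-> [Hy _]]]; lra. Qed.

(** If the roots satisfied y <= z, [root_order] would give y^(2k+1) <= 1 + 2y = y^(2j+1), impossible
    for y > 1. *)
Lemma vs_increasing (j k : nat) : (1 <= j)%nat -> (j < k)%nat -> vs j < vs k.
Proof.
intros Hj Hjk.
destruct (vs_spec j Hj) as [y [-> [Hy Hyr]]].
destruct (vs_spec k ltac:(lia)) as [z [-> [Hz Hzr]]].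
enough (z < y) by lra; apply Rnot_le_lt; intros Hle.
assert (H : y ^ (2 * k + 1) <= 1 + 2 * y).
{ destruct (Req_dec y z) as [-> | Hne]; [lra |].
  replace (2 * k + 1)%nat with (S (2 * k)) in * by lia.
  apply Rlt_le, (root_order _ y z); lra. }
assert (H1 : y ^ (2 * j + 1) < y ^ (2 * k + 1)) by (apply Rlt_pow; [lra | lia]).
lra.
Qed.

Lemma ln_le_sub1 (t : R) : 0 < t -> ln t <= t - 1.
Proof.
intros Ht; destruct (Req_dec (ln t) 0) as [H0 | H0].
- rewrite H0; apply (f_equal exp) in H0; rewrite exp_ln, exp_0 in H0; lra.
- assert (H := exp_ineq1 (ln t) H0); rewrite exp_ln in H; lra.
Qed.

(** With y = 1 + z, logarithms of the root equation give 2 ln y = (ln(1 + 2y) - ln y)/k. A first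
    bound z = O(1/k), put back into ln y = z + O(z^2) and ln(1 + 2y) = ln 3 + O(z), gives z = ln
    3/(2k) + O(1/k^2). *)
Lemma vs_asymptotics (k : nat) :
  (1 <= k)%nat ->
  Rabs (vs k - (- (1 / 2) - ln 3 / (4 * INR k))) <= 20 * (1 / INR k ^ 2).
Proof.
intros Hk; destruct (vs_spec k Hk) as [y [-> [Hy Hroot]]].
assert (HK : 1 <= INR k) by (apply (le_INR 1); exact Hk).
set (K := INR k) in *; set (i := / K).
assert (Hi : i * K = 1) by (apply Rinv_l; lra).
assert (Hi1 : 0 < i) by (apply Rinv_0_lt_compat; lra).
assert (Hln : (2 * K + 1) * ln y = ln (1 + 2 * y)).
{ rewrite <- Hroot, ln_pow by lra; f_equal.
  rewrite plus_INR, mult_INR; simpl; fold K; ring. }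
assert (Hl3 : 0 < ln 3 <= 2).
{ split; [rewrite <- ln_1; apply ln_increasing; lra |].
  assert (H := ln_le_sub1 3); lra. }
assert (Hup : ln y <= y - 1) by (apply ln_le_sub1; lra).
assert (Hlo : 1 - / y <= ln y).
{ assert (H := ln_le_sub1 (/ y) ltac:(apply Rinv_0_lt_compat; lra)).
  rewrite ln_Rinv in H; lra. }
assert (HL : ln 3 <= ln (1 + 2 * y) <= ln 3 + 2 / 3 * (y - 1)).
{ split; [apply Rlt_le, ln_increasing; lra |].
  replace (1 + 2 * y) with (3 * ((1 + 2 * y) / 3)) by field.
  rewrite ln_mult by lra.
  assert (H := ln_le_sub1 ((1 + 2 * y) / 3) ltac:(lra)); lra. }
set (z := y - 1) in *; replace y with (1 + z) in * by (unfold z; ring).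
set (l := ln (1 + z)) in *; set (L := ln (1 + 2 * (1 + z))) in *.
assert (Hlo' : z - z ^ 2 <= l).
{ eapply Rle_trans; [| exact Hlo].
  apply (Rmult_le_reg_r (1 + z)); [lra |].
  field_simplify; [| lra]; assert (0 <= z ^ 3) by (apply pow_le; lra); nra. }
assert (Hlz : z / 2 <= l).
{ eapply Rle_trans; [| exact Hlo].
  apply (Rmult_le_reg_r (1 + z)); [lra |].
  field_simplify; [| lra]; nra. }
(* Indeed z K <= 2 K l = L - l <= 2 + z/6 < 3. *)
assert (Hz : z <= 3 * i).
{ apply (Rmult_le_reg_r K); [lra |]; nra. }
assert (Hz2 : z ^ 2 <= 9 * i ^ 2) by nra.
replace (1 / K ^ 2) with (i ^ 2) by (unfold i; field; lra).
replace (ln 3 / (4 * K)) with (ln 3 / 4 * i) by (unfold i; field; lra).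
assert (HlL : 2 * l = (L - l) * i).
{ apply (Rmult_eq_reg_r K); [| lra].
  replace ((L - l) * i * K) with ((L - l) * (i * K)) by ring.
  rewrite Hi; lra. }
apply Rabs_le; split.
- assert (Hub : 2 * l <= (ln 3 + 2 / 3 * z) * i) by nra.
  nra.
- assert (Hlb : 2 * l >= (ln 3 - z) * i) by nra.
  nra.
Qed.

(** * Closed formulas and the maximizers between and at the thresholds *)

Lemma xmax_minus_delta (k : nat) : xmax_minus (S k) = 1 / 2 - delta (S k).
Proof.
unfold xmax_minus, delta; replace (2 * S k - 1)%nat with (1 + 2 * k)%nat by lia.
rewrite pow_add, pow_mult; replace (2 ^ 2) with 4 by ring.
simpl; field; apply pow_nonzero; lra.
Qed.

Lemma xmax_plus_delta (k : nat) : xmax_plus (S k) = 1 / 2 + delta (S k).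
Proof.
unfold xmax_plus, delta; replace (2 * S k - 1)%nat with (1 + 2 * k)%nat by lia.
rewrite pow_add, pow_mult; replace (2 ^ 2) with 4 by ring.
simpl; field; apply pow_nonzero; lra.
Qed.

Lemma Mformula_at_delta (k : nat) (y : R) :
  1 < y < 2 -> Mformula (S k) (- y / 2) = T (- y / 2) (1 / 2 - delta (S k)).
Proof.
intros Hy; rewrite neg_at_delta by exact Hy.
assert (Hc := neg_two_fifths y Hy).
set (c := T (- y / 2) (2 / 5)) in *.
assert (Hc' : c = 2 * (4 - y) / 5 / (4 - y ^ 2)).
{ rewrite <- Hc; field; nra. }
rewrite Hc'; clear c Hc Hc'.
unfold Mformula, tilt.
replace (2 * S k - 1)%nat with (1 + 2 * k)%nat by lia.
rewrite !pow_add, !pow_mult, pow_1; replace (2 ^ 2) with 4 by ring.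
replace ((- y / 2) ^ 2) with (y ^ 2 / 4) by field.
rewrite <- !(tech_pow_Rmult _ k).
assert (Hp : (y ^ 2 / 4) ^ k = (y ^ 2) ^ k / 4 ^ k)
  by (unfold Rdiv; rewrite Rpow_mult_distr, pow_inv; reflexivity).
rewrite Hp.
assert (H1 : (y ^ 2) ^ k <> 0) by (apply pow_nonzero; nra).
assert (H2 : 4 ^ k <> 0) by (apply pow_nonzero; lra).
field; repeat split; nra.
Qed.

Lemma maximizers_between (k : nat) (v : R) :
  (1 <= k)%nat -> vs (k - 1) < v < vs k ->
  (forall x : R, E v x <-> x = xmax_minus k \/ x = xmax_plus k) /\
  is_M v (Mformula k v).
Proof.
intros Hk Hv; assert (Hvk := vs_bounds k Hk).
destruct k as [| n]; [lia |].
replace (S n - 1)%nat with n in Hv by lia.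
assert (Hgt : -1 < v).
{ destruct n as [| m]; [simpl in Hv; lra |].
  assert (H := vs_bounds (S m) ltac:(lia)); lra. }
set (y := -2 * v); replace v with (- y / 2) in * by (unfold y; field).
assert (Hy : 1 < y < 2) by lra; clearbody y.
(* For n = 0 this is y < 1 + 2y; otherwise v > vs n puts y below the root z. *)
assert (H1 : y ^ (2 * n + 1) < 1 + 2 * y).
{ destruct n as [| m]; [simpl; lra |].
  destruct (vs_spec (S m) ltac:(lia)) as [z [Hz [Hz1 Hz2]]]; rewrite Hz in Hv.
  replace (2 * S m + 1)%nat with (S (2 * S m)) in * by lia.
  apply (root_order _ y z); lra. }
assert (H2 : 1 + 2 * y < y ^ (2 * S n + 1)).
{ destruct (vs_spec (S n) ltac:(lia)) as [z [Hz [Hz1 Hz2]]]; rewrite Hz in Hv.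
  apply Rnot_le_lt; intros Hle.
  replace (2 * S n + 1)%nat with (S (2 * S n)) in * by lia.
  assert (H := root_order _ z y ltac:(lra) Hle); lra. }
rewrite Mformula_at_delta by exact Hy; split.
- intros x; rewrite (neg_maximizers y Hy n H1 ltac:(lra)).
  rewrite xmax_minus_delta, xmax_plus_delta.
  split; [intros [H | [Ht _]]; [exact H |] | auto].
  (* The strict inequality [H2] rules out tilt 1, hence a second pair. *)
  apply tilt_eq_1 in Ht; [lra | exact Hy].
- apply neg_is_M; [exact Hy | exact H1 | lra].
Qed.

Lemma maximizers_at_vs (k : nat) :
  (1 <= k)%nat ->
  (forall x : R, E (vs k) x <->
     x = xmax_minus k \/ x = xmax_minus (k + 1) \/
     x = xmax_plus (k + 1) \/ x = xmax_plus k) /\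
  is_M (vs k) (Mformula k (vs k)).
Proof.
intros Hk; destruct (vs_spec k Hk) as [y [-> [Hy Hroot]]].
destruct k as [| n]; [lia |].
assert (H1 : y ^ (2 * n + 1) < 1 + 2 * y).
{ rewrite <- Hroot; apply Rlt_pow; [lra | lia]. }
rewrite Mformula_at_delta by exact Hy; split.
- intros x; rewrite (neg_maximizers y Hy n H1 ltac:(lra)).
  replace (S n + 1)%nat with (S (S n)) by lia.
  rewrite !xmax_minus_delta, !xmax_plus_delta.
  assert (Ht := tilt_1_eq y Hy (S n) Hroot); tauto.
- apply neg_is_M; [exact Hy | exact H1 | lra].
Qed.

Theorem theorem12 :
  (forall v : R, 1 / 2 < v < 1 ->
     (forall x : R, E v x <-> x = 1 / 3 \/ x = 2 / 3) /\
     is_M v (1 / (3 * (1 - v))))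
  /\
  ((forall x : R, E (1 / 2) x <->
      exists b : nat -> nat, binary_expansion b x /\
        forall k : nat, (b (2 * k + 1) + b (2 * k + 2) = 1)%nat) /\
   (forall x : R, E (1 / 2) x <->
      exists b : nat -> nat, binary_expansion b x /\
        forall k : nat,
          (b (2 * k + 1) = 0 /\ b (2 * k + 2) = 1)%nat \/
          (b (2 * k + 1) = 1 /\ b (2 * k + 2) = 0)%nat) /\
   is_M (1 / 2) (2 / 3) /\
   Glb_Rbar (E (1 / 2)) = Finite (1 / 3) /\
   Lub_Rbar (fun x : R => E (1 / 2) x /\ 0 <= x <= 1 / 2) = Finite (5 / 12) /\
   Lub_Rbar (E (1 / 2)) = Finite (2 / 3))
  /\
  (forall v : R, - (1 / 2) <= v <= 1 / 4 ->
     (forall x : R, E v x <-> x = 1 / 2) /\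
     is_M v (1 / 2))
  /\
  (exists vs : nat -> R,
     vs 0%nat = -1 /\
     (forall k : nat, (1 <= k)%nat ->
        unique (fun x : R => x < 0 /\ Ptilde (2 * k) x = 0) (vs k) /\
        -1 < vs k < - (1 / 2)) /\
     (forall j k : nat, (1 <= j)%nat -> (j < k)%nat -> vs j < vs k) /\
     (exists C : R, eventually (fun k : nat =>
        Rabs (vs k - (- (1 / 2) - ln 3 / (4 * INR k))) <= C * (1 / INR k ^ 2))) /\
     (forall (k : nat) (v : R), (1 <= k)%nat -> vs (k - 1)%nat < v < vs k ->
        (forall x : R, E v x <-> x = xmax_minus k \/ x = xmax_plus k) /\
        is_M v (Mformula k v)) /\
     (forall k : nat, (1 <= k)%nat ->
        (forall x : R, E (vs k) x <->
           x = xmax_minus k \/ x = xmax_minus (k + 1) \/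
           x = xmax_plus (k + 1) \/ x = xmax_plus k) /\
        is_M (vs k) (Mformula k (vs k)))).

Proof.
split; [| split; [| split]].
- intros v Hv; split; [intros x; apply maximizers_large, Hv |].
  apply is_M_third; lra.
- split; [| split; [| split; [| split; [| split]]]].
  + intros x; rewrite E_half_iff.
    split; intros [b [Hx Hb]]; exists b; split; try exact Hx;
      apply block_expansion_sum; exact Hb.
  + exact E_half_iff.
  + exact is_M_half.
  + apply Glb_Rbar_min; [exact E_half_third | apply E_half_bounds].
  + apply Lub_Rbar_max; [split; [exact E_half_five_twelfths | lra] |].
    intros x [HE Hx].
    (* Since 4x - 1 is again a maximizer, it is at most 2/3, which gives x <= 5/12. *)
    assert (H := E_half_bounds _ (E_half_block01 x HE ltac:(lra))); lra.
  + apply Lub_Rbar_max; [exact E_half_two_thirds | apply E_half_bounds].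
- exact maximizers_middle.
- exists vs; split; [reflexivity |].
  split; [intros k Hk; split; [apply vs_unique_root | apply vs_bounds]; exact Hk |].
  split; [exact vs_increasing |].
  split; [| split; [exact maximizers_between | exact maximizers_at_vs]].
  exists 20, 1%nat; exact vs_asymptotics.
Qed.
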